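(* Let $r\ge 2$ be an integer and let $A$ be a decomposable nonnegative $r$-potent real square matrix, with $k=\operatorname{rank}(A)$. Then any maximal standard block triangularization of $A$ has the following properties: (1) Each diagonal block is either zero or an indecomposable $r$-potent matrix of rank at most $r-1$. (2) If $n$ is the number of non-zero diagonal blocks, then $\frac{k}{r-1}\le n\le k$. (3) The total number of diagonal blocks (including zero blocks) lies between $\frac{k}{r-1}$ and $2k+1$.
   Context: A real matrix is nonnegative if all its entries are $\ge 0$. A square matrix $A$ is $r$-potent if $A^r=A$. An $N\times N$ real matrix $A$ is decomposable if there is a permutation matrix $P$ such that $P^{-1}AP=\begin{pmatrix} B & C\\ 0 & D\end{pmatrix}$ with $B$ and $D$ square (of positive size); equivalently, some standard subspace other than $\{0\}$ and $\mathbb{R}^N$ is invariant under $A$. Otherwise $A$ is indecomposable. A standard subspace of $\mathbb{R}^N$ is a subspace spanned by a subset of the standard basis vectors. A chain $\{0\}=\mathcal{N}_0\subsetneq \mathcal{N}_1\subsetneq\cdots\subsetneq\mathcal{N}_m=\mathbb{R}^N$ of standard subspaces, each invariant under $A$, gives a standard block triangularization of $A$: there is a permutation matrix $P$ such that $P^{-1}AP$ is block upper triangular with $m$ diagonal blocks, the $i$-th diagonal block being the compression of $A$ to the gap $\mathcal{N}_i\ominus\mathcal{N}_{i-1}$ (the orthogonal complement of $\mathcal{N}_{i-1}$ in $\mathcal{N}_i$), i.e. the restriction of $QAQ$ to the range of $Q$, where $Q$ is the orthogonal projection onto that gap. The block triangularization is maximal if the chain is maximal among chains of standard subspaces invariant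 under $A$.
   Formalization: In (3), the total number of diagonal blocks is counted with adjacent diagonal blocks that together form a zero block counted as one; with the literal count for a maximal chain the upper bound 2k+1 fails (A = 0 of size 2 has k = 0 and two blocks). *)

(* Defs.v *)
From mathcomp Require Import all_boot all_order all_algebra all_fingroup.
From mathcomp Require Import reals.

Set Implicit Arguments.
Unset Strict Implicit.
Unset Printing Implicit Defensive.

Import Order.TTheory GRing.Theory Num.Theory.
Local Open Scope ring_scope.

Definition nonneg_mx (R : numDomainType) (N : nat) (A : 'M[R]_N) : Prop :=
  forall i j, 0 <= A i j.

Definition r_potent (R : fieldType) (N r : nat) (A : 'M[R]_N) : Prop :=
  A ^+ r = A.

(* Successor dimensions force both diagonal blocks B and D to have positive
   size. *)
Definition decomposable (R : fieldType) (N : nat) (A : 'M[R]_N) : Prop :=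
  exists (p q : nat) (e : (p.+1 + q.+1)%N = N) (s : 'S_N)
         (B : 'M[R]_p.+1) (C : 'M[R]_(p.+1, q.+1)) (D : 'M[R]_q.+1),
    invmx (perm_mx s) *m A *m perm_mx s = castmx (e, e) (block_mx B C 0 D).

Definition indecomposable (R : fieldType) (N : nat) (A : 'M[R]_N) : Prop :=
  ~ decomposable A.

(* Matrices act on column vectors.  A standard subspace is encoded by the set S
   of indices of the standard basis vectors that span it. *)
Definition std_space (R : fieldType) (N : nat) (S : {set 'I_N}) :
    {vspace 'cV[R]_N} :=
  <<[seq (delta_mx i ord0 : 'cV[R]_N) | i <- enum S]>>%VS.

Definition invariant_under (R : fieldType) (N : nat) (A : 'M[R]_N)
    (V : {vspace 'cV[R]_N}) : Prop :=
  forall v, v \in V -> A *m v \in V.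

(* The chain {0} = N_0 < N_1 < ... < N_m = R^N is encoded by the sequence
   c = [:: S_1; ...; S_m] of index sets, with S_0 = set0 left implicit; thus
   size c = m is the number of diagonal blocks. *)
Definition std_chain (R : fieldType) (N : nat) (A : 'M[R]_N)
    (c : seq {set 'I_N}) : Prop :=
  [/\ path (fun S T : {set 'I_N} => S \proper T) set0 c,
      last set0 c = [set: 'I_N] &
      forall S, S \in c -> invariant_under A (std_space R S)].

Definition maximal_std_chain (R : fieldType) (N : nat) (A : 'M[R]_N)
    (c : seq {set 'I_N}) : Prop :=
  std_chain A c /\
  forall c', std_chain A c' -> {subset c <= c'} -> c' = c.

(* The orthogonal complement of span S_(i-1) in span S_i is the standard
   subspace indexed by S_i :\: S_(i-1). *)
Definition gaps (N : nat) (c : seq {set 'I_N}) : seq {set 'I_N} :=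
  pairmap (fun S T => T :\: S) set0 c.

(* The compression of A to the standard subspace indexed by G: the matrix, in
   the standard basis of the range of Q, of the restriction of Q A Q, where Q
   is the orthogonal projection onto that subspace. *)
Definition diag_block (R : fieldType) (N : nat) (A : 'M[R]_N)
    (G : {set 'I_N}) : 'M[R]_#|G| :=
  mxsub enum_val enum_val A.

Definition nb_nonzero_blocks (R : fieldType) (N : nat) (A : 'M[R]_N)
    (c : seq {set 'I_N}) : nat :=
  count (fun G => diag_block A G != 0) (gaps c).

(* In a maximal chain every zero diagonal block is 1 x 1, so the number of zero
   blocks is not bounded in terms of the rank (A = 0 of size N has rank 0 and N
   blocks).  A bound on the total number of blocks therefore counts adjacent
   diagonal blocks that together form a zero block as a single one: an
   intermediate term T of ... S < T < U ... is dropped exactly when the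
   compression of A to U :\: S is zero. *)
Fixpoint merge_zeros_from (R : fieldType) (N : nat) (A : 'M[R]_N)
    (S : {set 'I_N}) (c : seq {set 'I_N}) : seq {set 'I_N} :=
  if c is T :: c' then
    if c' is U :: _ then
      if diag_block A (U :\: S) == 0 then merge_zeros_from A S c'
      else T :: merge_zeros_from A T c'
    else [:: T]
  else [::].

Definition merge_zeros (R : fieldType) (N : nat) (A : 'M[R]_N)
    (c : seq {set 'I_N}) : seq {set 'I_N} :=
  merge_zeros_from A set0 c.

Lemma gaps_merge_zeros (R : fieldType) (N : nat) (A : 'M[R]_N)
    (c : seq {set 'I_N}) (G : {set 'I_N}) :
  G \in gaps (merge_zeros A c) -> G \in gaps c \/ diag_block A G = 0.
Proof.
rewrite /gaps /merge_zeros.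
suff gen S S' : S' = S \/ (if c is T :: _ then diag_block A (T :\: S) = 0
                           else True) ->
    G \in pairmap (fun S T => T :\: S) S (merge_zeros_from A S c) ->
    G \in pairmap (fun S T => T :\: S) S' c \/ diag_block A G = 0.
  by apply: gen; left.
elim: c S S' => [|T [|U c] IH] S S' hS; first by [].
  rewrite /= !inE => /eqP ->; case: hS => [->|]; last by right.
  by left.
rewrite [merge_zeros_from _ _ _]/=; case: eqP => [z|_].
  move=> /(IH S T) []; first by right.
    by move=> h; left; rewrite inE h orbT.
  by right.
rewrite inE => /orP [/eqP ->|/(IH T T) []]; last by right.
- by case: hS => [->|]; [left; rewrite inE eqxx | right].
- by left.
- by move=> h; left; rewrite inE h orbT.
Qed.

(* Main.v *)
Require Import Defs.
From mathcomp Require Import all_boot all_order all_algebra all_fingroup.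
From mathcomp Require Import reals.
From mathcomp Require Import zify.
Import Order.TTheory GRing.Theory Num.Theory.
Local Open Scope ring_scope.

(** Let B be a diagonal block of a maximal chain; it is r-potent and leaves no
    nontrivial standard subspace invariant.  If B is nonzero, the row vector
    u = 1 (B + ... + B^(r-1)) is fixed by B and positive.  If B had rank at
    least r, some nonzero v in its range would satisfy the r-1 linear conditions
    (B^i v)_a = 0, for a fixed index a.  Then w = |v| + |B v| + ... + |B^(r-2) v|
    satisfies w <= B w, hence w = B w because u w = u B w; so the support of w
    spans a nontrivial invariant standard subspace, a contradiction.

    The rank of an r-potent matrix A is the trace of the idempotent A^(r-1), and
    is therefore the sum of the ranks of the diagonal blocks.  Finally, two
    adjacent zero blocks form an r-potent matrix of square zero, which is zero;
    hence after merging no two zero blocks are adjacent. *)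

(** * Invariant standard subspaces in terms of index sets *)

(** Entrywise form of the invariance of the span of the basis vectors indexed by [S]: column [j] is
    the image of the [j]-th basis vector. *)
Definition closed_mx {R : fieldType} {N} (A : 'M[R]_N) (S : {set 'I_N}) :=
  forall i j, j \in S -> i \notin S -> A i j = 0.

Lemma mem_std_space (R : fieldType) N (S : {set 'I_N}) (v : 'cV[R]_N) :
  v \in std_space R S <-> (forall i, i \notin S -> v i ord0 = 0).
Proof.
split=> [vS i iS|vS].
  rewrite (coord_span (X := in_tuple _) vS) summxE big1 // => k _.
  have kS : (k < size (enum S))%N by rewrite -(size_map (fun i => delta_mx i ord0 : 'cV[R]_N)).
  rewrite mxE /= (nth_map i) // mxE; case: eqP => [ik|_]; last by rewrite mulr0.
  by move: iS; rewrite ik -mem_enum mem_nth.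
rewrite [v]matrix_sum_delta; apply: memv_suml => i _.
rewrite big_ord1; have [iS|iS] := boolP (i \in S); last by rewrite vS // scale0r mem0v.
by apply/memvZ/memv_span/map_f; rewrite mem_enum.
Qed.

Lemma invariant_underP (R : fieldType) N (A : 'M[R]_N) (S : {set 'I_N}) :
  invariant_under A (std_space R S) <-> closed_mx A S.
Proof.
split=> [AS i j jS iS|AS v /mem_std_space vS].
  have /AS/mem_std_space/(_ i iS) : (delta_mx j ord0 : 'cV[R]_N) \in std_space R S.
    by apply/mem_std_space => k kS; rewrite mxE; case: eqP kS => // ->; rewrite jS.
  by rewrite -colE mxE.
apply/mem_std_space => i iS; rewrite mxE big1 // => j _.
by have [jS|jS] := boolP (j \in S); [rewrite AS ?mul0r | rewrite vS ?mulr0].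
Qed.

Lemma decomposable_closed (R : fieldType) N (A : 'M[R]_N) :
  decomposable A -> exists S, [/\ closed_mx A S, S != set0 & S != setT].
Proof.
case=> p [q] [e] [s] [B] [C] [D]; case: N / e A s => A s.
(* Conjugation by [perm_mx s] becomes a relabelling: the block matrix has entry
   [A (s^-1 i) (s^-1 j)] at [i, j], so the first [p.+1] indices pull back to a closed set. *)
rewrite -[invmx _]/((perm_mx s)^-1) -perm_mxV -row_permE -{2}(invgK s) -col_permE castmx_id => /matrixP eqA.
exists [set s^-1%g (lshift _ j) | j : 'I_p.+1]; split.
- move=> i _ /imsetP[j _ ->] iS.
  have := eqA (s i) (lshift _ j); rewrite mxE [LHS]mxE permK => ->.
  case: (split_ordP (s i)) => k sik; last by rewrite sik block_mxEdl mxE.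
  by case/imsetP: iS; exists k => //; rewrite -sik permK.
- by apply/set0Pn; exists (s^-1%g (lshift _ ord0)); apply: imset_f.
- apply/eqP => /setP/(_ (s^-1%g (rshift _ ord0))).
  by rewrite in_setT => /imsetP[j _ /perm_inj/eqP]; rewrite eq_rlshift.
Qed.

(** * Compressions to gaps *)

Lemma diag_block_eq0 (R : fieldType) N (A : 'M[R]_N) (G : {set 'I_N}) :
  diag_block A G = 0 <-> {in G &, forall i j, A i j = 0}.
Proof.
split=> [/matrixP A0 i j iG jG|A0]; last first.
  by apply/matrixP => i j; rewrite !mxE A0 ?enum_valP.
by have := A0 (enum_rank_in iG i) (enum_rank_in iG j); rewrite !mxE !enum_rankK_in.
Qed.

Lemma closed_mx_mul (R : fieldType) N (A B : 'M[R]_N) S :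
  closed_mx A S -> closed_mx B S -> closed_mx (A *m B) S.
Proof.
move=> AS BS i j jS iS; rewrite mxE big1 // => k _.
by have [kS|kS] := boolP (k \in S); [rewrite AS ?mul0r | rewrite BS ?mulr0].
Qed.

Lemma closed_mx_exp (R : fieldType) N (A : 'M[R]_N) S n :
  closed_mx A S -> closed_mx (A ^+ n) S.
Proof.
move=> AS; elim: n => [|n IH]; last by rewrite exprS; apply: closed_mx_mul.
by move=> i j jS iS; rewrite mxE; case: eqP iS => // ->; rewrite jS.
Qed.

(** An index [k] outside the gap contributes nothing to entry [i, j] of the product: [A i k = 0] if
    [k] is in [S], and [B k j = 0] if [k] is outside [T]. *)
Lemma diag_block_mul (R : fieldType) N (A B : 'M[R]_N) S T :
  closed_mx A S -> closed_mx B T ->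
  diag_block (A *m B) (T :\: S) = diag_block A (T :\: S) *m diag_block B (T :\: S).
Proof.
move=> AS BT; apply/matrixP => i j; rewrite !mxE (bigID (mem (T :\: S))) /=.
rewrite [X in _ + X]big1 ?addr0 => [|k].
  by rewrite big_enum_val; apply: eq_bigr => k _; rewrite !mxE.
have := enum_valP i; have := enum_valP j; rewrite !inE.
move=> /andP[_ jT] /andP[iS _]; rewrite negb_and negbK => /orP[kS|kT].
  by rewrite AS ?mul0r.
by rewrite BT ?mulr0.
Qed.

Lemma diag_block_exp (R : fieldType) N (A : 'M[R]_N) S T n :
  closed_mx A S -> closed_mx A T ->
  diag_block (A ^+ n) (T :\: S) = diag_block A (T :\: S) ^+ n.
Proof.
move=> AS AT; elim: n => [|n IH].
  by apply/matrixP => i j; rewrite !mxE (inj_eq enum_val_inj).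
by rewrite !exprS -[A * _]/(A *m _) diag_block_mul ?IH //; apply: closed_mx_exp.
Qed.

Lemma diag_block_r_potent (R : fieldType) N r (A : 'M[R]_N) S T :
  closed_mx A S -> closed_mx A T -> r_potent r A -> r_potent r (diag_block A (T :\: S)).
Proof. by move=> AS AT Ar; rewrite /r_potent -diag_block_exp // Ar. Qed.

Lemma mxtrace_diag_block (R : fieldType) N (A : 'M[R]_N) (G : {set 'I_N}) :
  \tr (diag_block A G) = \sum_(i in G) A i i.
Proof. by rewrite big_enum_val; apply: eq_bigr => i _; rewrite mxE. Qed.

(** * Rank as a trace *)

(** In a rank factorization [E = L *m M], cancelling [L] on the left and [M] on the right of
    [LMLM = LM] gives [M *m L = 1], whose size is the rank. *)
Lemma mxtrace_idempotent (R : fieldType) N (E : 'M[R]_N) :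
  E *m E = E -> \tr E = (\rank E)%:R.
Proof.
move=> EE; have := mulmx_base E.
have /row_freeP[D] := row_base_free E; have /row_fullP[C] := col_base_full E.
move: (col_base E) (row_base E) => L M CL MD LM.
rewrite -{1}LM mxtrace_mulC; suff -> : M *m L = 1%:M by rewrite mxtrace1.
have : C *m ((L *m M) *m (L *m M)) *m D = C *m (L *m M) *m D by rewrite LM EE.
by rewrite !mulmxA CL !mul1mx -!mulmxA MD mulmx1.
Qed.

(** The power [A ^+ r.-1] is idempotent, and it has the rank of [A] because each of the two is a
    multiple of the other. *)
Lemma mxrank_r_potent (R : fieldType) N r (A : 'M[R]_N) :
  (2 <= r)%N -> r_potent r A -> (\rank A)%:R = \tr (A ^+ r.-1).
Proof.
case: r => [|[|r]] // _ Ar; rewrite /= in Ar *.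
have EE : A ^+ r.+1 *m A ^+ r.+1 = A ^+ r.+1.
  rewrite -[_ *m _]exprD addSnnS exprD -[in RHS](addn1 r) exprD expr1.
  by rewrite Ar.
rewrite mxtrace_idempotent //; congr (_%:R); apply/eqP; rewrite eqn_leq.
rewrite {1}(_ : A = A *m A ^+ r.+1); last by rewrite -[_ *m _]exprS Ar.
by rewrite mxrankM_maxr exprSr mxrankM_maxr.
Qed.

(** * Rank bound for irreducible nonnegative r-potent matrices *)

Section IrreducibleRank.
Context {R : realFieldType} {N : nat} (B : 'M[R]_N).
Hypothesis B_ge0 : nonneg_mx B.
Hypothesis B_irr : forall S, closed_mx B S -> S = set0 \/ S = setT.

(** The zero set of [u] is closed: if [u j = 0], every term of the sum of the [u k * B k j]
    vanishes. *)
Lemma nonneg_fixed_row_gt0 (u : 'rV[R]_N) :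
  (forall i, 0 <= u ord0 i) -> u *m B = u -> u != 0 -> forall i, 0 < u ord0 i.
Proof.
move=> u_ge0 uB uN0.
have [|Z i|Z] := B_irr [set i | u ord0 i == 0].
- move=> i j; rewrite !inE => /eqP uj ui.
  have : \sum_k u ord0 k * B k j == 0.
    by rewrite -[X in _ == X]uj -{2}uB mxE.
  rewrite psumr_eq0 => [/allP/(_ i (mem_index_enum _))|k _]; last exact: mulr_ge0.
  by rewrite mulf_eq0 (negPf ui) => /eqP.
- by rewrite lt_def u_ge0 andbT; have := in_set0 i; rewrite -Z inE => ->.
- case/eqP: uN0; apply/rowP => i; rewrite mxE; apply/eqP.
  by have := in_setT i; rewrite -Z inE.
Qed.

(** Dually, the support of [w] is closed; it misses [a], so it is empty. *)
Lemma nonneg_fixed_col_eq0 (w : 'cV[R]_N) a :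
  (forall i, 0 <= w i ord0) -> B *m w = w -> w a ord0 = 0 -> w = 0.
Proof.
move=> w_ge0 Bw wa.
have [|Z|Z] := B_irr [set i | w i ord0 != 0].
- move=> i j; rewrite !inE negbK => wj /eqP wi.
  have : \sum_k B i k * w k ord0 == 0 by rewrite -[X in _ == X]wi -{2}Bw mxE.
  rewrite psumr_eq0 => [/allP/(_ j (mem_index_enum _))|k _]; last exact: mulr_ge0.
  by rewrite mulf_eq0 (negPf wj) orbF => /eqP.
- apply/colP => i; rewrite mxE; apply/eqP.
  by have := in_set0 i; rewrite -Z inE => /negbFE.
- by have := in_setT a; rewrite -Z inE wa eqxx.
Qed.

Lemma nonneg_mx_exp n : nonneg_mx (B ^+ n).
Proof.
elim: n => [|n IH] i j; first by rewrite mxE ler0n.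
by rewrite exprS mxE sumr_ge0 // => k _; rewrite mulr_ge0.
Qed.

Lemma fixed_row_exists r : (2 <= r)%N -> r_potent r B -> B != 0 ->
  exists u : 'rV[R]_N, u *m B = u /\ forall i, 0 < u ord0 i.
Proof.
case: r => [|[|r]] // _ Br BN0; rewrite /r_potent in Br.
(* As [B ^+ r = B] for the original [r], multiplication by [B] permutes the summands of [P]
   cyclically. *)
pose P : 'M[R]_N := \sum_(i < r.+1) B ^+ i.+1.
have P_ge0 : nonneg_mx P.
  by move=> i j; rewrite summxE sumr_ge0 // => k _; apply: nonneg_mx_exp.
have PB : P *m B = P.
  rewrite mulmx_suml (eq_bigr (fun i : 'I_r.+1 => B ^+ i.+2)) => [|i _]; last first.
    by rewrite -[_ *m _]exprSr.
  by rewrite big_ord_recr /= Br {1}/P big_ord_recl addrC.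
pose u : 'rV[R]_N := const_mx 1 *m P.
have uB : u *m B = u by rewrite -mulmxA PB.
exists u; split=> //; apply: nonneg_fixed_row_gt0 => // [i|].
  by rewrite mxE sumr_ge0 // => k _; rewrite mulr_ge0 // mxE.
(* If the column sums of the nonnegative [P] vanish, so does [P], and with it its first summand
   [B]. *)
apply: contra BN0 => /eqP/rowP u0; apply/eqP/matrixP => i j; rewrite mxE.
have /eqP := u0 j; rewrite !mxE psumr_eq0 => [|k _]; last by rewrite mulr_ge0 // mxE.
move=> /allP/(_ i (mem_index_enum _)); rewrite mxE mul1r summxE psumr_eq0; last first.
  by move=> k _; apply: nonneg_mx_exp.
by move=> /allP/(_ ord0 (mem_index_enum _)) /eqP.
Qed.

Lemma irreducible_r_potent_rank r :
  (2 <= r)%N -> r_potent r B -> (\rank B <= r - 1)%N.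
Proof.
move=> r2 Br; have [->|BN0] := eqVneq B 0; first by rewrite mxrank0.
have [u [uB u_gt0]] := fixed_row_exists r r2 Br BN0.
case: r r2 Br => [|[|r]] // _ Br; rewrite /r_potent subn1 /= in Br *.
(* For [N = 0] the matrix would be zero. *)
have [a _] : exists a : 'I_N, true.
  case: N B BN0 => [|n] C CN0; last by exists ord0.
  by case/eqP: CN0; apply/matrixP; case.
(* After the case analysis [r.+1] is the original exponent minus one. Row [i] of [K] is the
   functional taking [v] to entry [a] of [B ^+ i *m v]. *)
pose K : 'M[R]_(r.+1, N) := \matrix_(i < r.+1) row a (B ^+ i).
suff BK : (B <= K *m B)%MS.
  by apply: leq_trans (mxrankS BK) (leq_trans (mxrankM_maxl _ _) (rank_leq_row _)).
(* The columns of [Q] are killed by [K *m B]; the goal is that [B] kills them too, that is, [v = 0]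
   for each [v] below. *)
rewrite submxE; set Q := cokermx _.
apply/eqP/matrixP => b k; rewrite [RHS]mxE.
pose v : 'cV[R]_N := B *m col k Q.
have Kv i : (i < r.+1)%N -> (B ^+ i *m v) a ord0 = 0.
  move=> ir; have : K *m v = 0.
    by rewrite /v mulmxA colE (mulmxA _ Q) mulmx_coker mul0mx.
  move/colP/(_ (Ordinal ir)); rewrite [RHS]mxE => <-.
  by rewrite !mxE; apply: eq_bigr => l _; rewrite !mxE.
have Bv : B ^+ r.+1 *m v = v by rewrite /v mulmxA -[_ *m B]exprSr Br.
pose w : 'cV[R]_N := \col_i \sum_(k < r.+1) `|(B ^+ k *m v) i ord0|.
have w_ge0 i : 0 <= w i ord0 by rewrite mxE sumr_ge0.
have wBw i : w i ord0 <= (B *m w) i ord0.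
  have -> : w i ord0 = \sum_(k < r.+1) `|(B ^+ k.+1 *m v) i ord0|.
    by rewrite mxE big_ord_recl [RHS]big_ord_recr /= Bv expr0 mul1mx addrC.
  rewrite [leRHS]mxE (eq_bigr (fun j => \sum_(k < r.+1) B i j * `|(B ^+ k *m v) j ord0|)); last first.
    by move=> j _; rewrite mxE mulr_sumr.
  rewrite exchange_big ler_sum // => l _.
  rewrite exprS -mulmxA mxE (le_trans (ler_norm_sum _ _ _)) // ler_sum // => j _.
  by rewrite normrM ger0_norm.
have Bw : B *m w = w.
  have : u *m (B *m w - w) = 0 by rewrite mulmxBr mulmxA uB subrr.
  move/rowP/(_ ord0)/eqP; rewrite !mxE psumr_eq0 => [/allP uw0|i _]; last first.
    by rewrite mulr_ge0 ?(ltW (u_gt0 _)) // mxE [X in _ + X]mxE subr_ge0.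
  apply/colP => i; have := uw0 i (mem_index_enum _).
  by rewrite mulf_eq0 gt_eqF //= => /eqP/eqP; rewrite !mxE subr_eq0 => /eqP.
have /colP/(_ b) : w = 0.
  apply: (nonneg_fixed_col_eq0 w a) => //; rewrite mxE big1 // => l _.
  by rewrite Kv ?normr0.
rewrite !mxE => /eqP; rewrite psumr_eq0 // => /allP/(_ ord0 (mem_index_enum _)).
rewrite normr_eq0 expr0 mul1mx => /eqP; rewrite !mxE => vb.
by apply: etrans vb; apply: eq_bigr => l _; rewrite [in RHS]mxE.
Qed.

End IrreducibleRank.

(** * Gaps of a maximal chain *)

(** A closed set strictly between two consecutive terms could be inserted into the chain. *)
Lemma maximal_gap (R : fieldType) N (A : 'M[R]_N) c G :
  maximal_std_chain A c -> G \in gaps c ->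
  exists S T, [/\ G = T :\: S, closed_mx A S, closed_mx A T, S \subset T &
    forall U, closed_mx A U -> S \subset U -> U \subset T -> U = S \/ U = T].
Proof.
case=> -[c_path c_last c_inv] c_max /(nthP set0)[k]; rewrite size_pairmap => kc <-.
rewrite (nth_pairmap set0) //.
(* Prepending [set0] shifts the indices by one, so [S] is the term just before [T]. *)
set S := nth set0 (set0 :: c) k; set T := nth set0 c k.
have ST : S \proper T by move/(pathP set0): c_path; apply.
have cT : T \in c by rewrite mem_nth.
have AS : closed_mx A S.
  rewrite /S; case: k {T ST cT S} kc => [|k] kc /= => [i j|]; first by rewrite inE.
  by apply/invariant_underP/c_inv/mem_nth/ltnW.
exists S, T; split=> //; first by apply/invariant_underP/c_inv.
  exact: proper_sub.
move=> U AU SU UT.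
have [->|US] := eqVneq U S; first by left.
have [->|UnT] := eqVneq U T; first by right.
have SpU : S \proper U by rewrite properEneq eq_sym US.
have UpT : U \proper T by rewrite properEneq UnT.
have [c1 [c2 [c_cat S_last]]] : exists c1 c2, c = c1 ++ T :: c2 /\ last set0 c1 = S.
  exists (take k c), (drop k.+1 c); rewrite -drop_nth // cat_take_drop; split=> //.
  by rewrite (last_nth set0) size_take kc -[_ :: take _ _]/(take k.+1 (set0 :: c)) nth_take.
clearbody S T; move: c_path c_last c_inv c_max; rewrite {}c_cat => c_path c_last c_inv c_max.
(* Maximality would identify the refined chain with the original one, but their lengths differ by
   one. *)
suff /(congr1 size)/eqP : c1 ++ U :: T :: c2 = c1 ++ T :: c2.
  by rewrite !size_cat /=; lia.
apply: c_max => [|V]; last by rewrite !mem_cat !inE => /or3P[]->; rewrite ?orbT.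
move: c_path c_last c_inv; rewrite cat_path last_cat S_last /=.
move=> /and3P[p1 _ p2] lT c_inv; split.
- by rewrite cat_path S_last /= p1 SpU UpT.
- by rewrite last_cat.
- move=> V; rewrite mem_cat in_cons => VV.
  have [->|VnU] := eqVneq V U; first exact/invariant_underP.
  by apply: c_inv; rewrite mem_cat; move: VV; rewrite (negPf VnU).
Qed.

(** A set closed for the block, lifted to indices of [A] and joined to [S], is closed for [A] and
    lies between [S] and [T]. *)
Lemma diag_block_irreducible (R : fieldType) N (A : 'M[R]_N) (S T : {set 'I_N}) :
  closed_mx A S -> closed_mx A T -> S \subset T ->
  (forall U, closed_mx A U -> S \subset U -> U \subset T -> U = S \/ U = T) ->
  forall H, closed_mx (diag_block A (T :\: S)) H -> H = set0 \/ H = setT.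
Proof.
move=> AS AT ST min_ST H AH; set G := T :\: S in H AH *.
pose V := [set enum_val x | x in H].
have memV x : (enum_val x \in V) = (x \in H) by rewrite mem_imset //; apply: enum_val_inj.
have VG : V \subset T :\: S by apply/subsetP => _ /imsetP[x _ ->]; apply: enum_valP.
have [||SV|SV] := min_ST (S :|: V) _ (subsetUl _ _).
- move=> i j; rewrite !inE => jSV; rewrite negb_or => /andP[iS iV].
  case/orP: jSV => [jS|jV]; first exact: AS.
  have /setDP[jT jS] := subsetP VG j jV.
  have [iT|iT] := boolP (i \in T); last exact: AT.
  have iG : i \in G by rewrite !inE iS.
  case/imsetP: jV => y yH ->.
  have := AH (enum_rank_in iG i) y yH; rewrite mxE enum_rankK_in //; apply.
  by rewrite -memV enum_rankK_in.
- by rewrite subUset ST (subset_trans VG) // subsetDl.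
- left; apply/setP => x; rewrite -memV inE; apply/negbTE/negP => xV.
  have /setDP[_ /negP[]] := subsetP VG _ xV.
  by rewrite -SV inE xV orbT.
- right; apply/setP => x; rewrite -memV inE.
  have /setDP[xT xS] := enum_valP x.
  by move: xT; rewrite -SV inE (negPf xS).
Qed.

(** * Merging zero blocks *)

Lemma diag_block_adjacent_zeros (R : fieldType) N r (A : 'M[R]_N) (S T U : {set 'I_N}) :
  (2 <= r)%N -> r_potent r A ->
  closed_mx A S -> closed_mx A T -> closed_mx A U ->
  diag_block A (T :\: S) = 0 -> diag_block A (U :\: T) = 0 ->
  diag_block A (U :\: S) = 0.
Proof.
move=> r2 Ar AS AT AU /diag_block_eq0 A1 /diag_block_eq0 A2.
have := diag_block_r_potent _ _ _ _ _ _ AS AU Ar; rewrite /r_potent => <-.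
case: r r2 {Ar} => [|[|r]] // _; rewrite !exprS mulrA.
suff -> : diag_block A (U :\: S) * diag_block A (U :\: S) = 0 by rewrite mul0r.
apply/matrixP => i j; rewrite !mxE big1 // => k _; rewrite !mxE.
have /setDP[iU iS] := enum_valP i; have /setDP[jU jS] := enum_valP j.
have /setDP[kU kS] := enum_valP k.
(* Only entries with row in [T] and column outside [T] can be nonzero, so one factor vanishes
   according to the side of [k]. *)
have [kT|kT] := boolP (enum_val k \in T).
  rewrite [X in X * _](_ : _ = 0) ?mul0r //.
  have [iT|iT] := boolP (enum_val i \in T); last exact: AT.
  by apply: A1; rewrite inE ?iS ?kS.
rewrite [X in _ * X](_ : _ = 0) ?mulr0 //.
have [jT|jT] := boolP (enum_val j \in T); first exact: AT.
by apply: A2; rewrite inE ?jT ?kT.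
Qed.

Lemma diag_block_sub0 (R : fieldType) N (A : 'M[R]_N) (G H : {set 'I_N}) :
  G \subset H -> diag_block A H = 0 -> diag_block A G = 0.
Proof.
move=> /subsetP GH /diag_block_eq0 A0; apply/diag_block_eq0 => i j iG jG.
by apply: A0; apply: GH.
Qed.

(** Each merged zero block is either the first block or preceded by a nonzero one. The boolean
    accounts for an initial zero block, which makes the induction work. *)
Lemma size_merge_zeros_from (R : fieldType) N r (A : 'M[R]_N) S c :
  (2 <= r)%N -> r_potent r A -> closed_mx A S ->
  path (fun S T : {set 'I_N} => S \proper T) S c ->
  (forall T, T \in c -> closed_mx A T) ->
  let n := count (fun G => diag_block A G != 0) (pairmap (fun S T => T :\: S) S c) in
  (n <= size (merge_zeros_from A S c)
     <= n.*2 + (if c is T :: _ then diag_block A (T :\: S) == 0%R else false))%N.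
Proof.
move=> r2 Ar; elim: c S => [|T [|U c] IH] S AS //.
  by move=> _ _ /=; case: eqP.
move=> /andP[ST TUc] Ac.
have AT : closed_mx A T by apply: Ac; rewrite mem_head.
have AU : closed_mx A U by apply: Ac; rewrite !inE eqxx orbT.
have Ac' V : V \in U :: c -> closed_mx A V by move=> Vc; apply: Ac; rewrite inE Vc orbT.
have TU : T \proper U by case/andP: TUc.
cbv zeta; have -> : merge_zeros_from A S [:: T, U & c] =
    if diag_block A (U :\: S) == 0%R then merge_zeros_from A S (U :: c)
    else T :: merge_zeros_from A T (U :: c) by [].
(* If [T] is dropped, both small blocks and the merged one are zero, so neither the count nor the
   boolean changes. *)
case: eqP => [US0|US].
  have TS0 : diag_block A (T :\: S) = 0.
    by apply: diag_block_sub0 US0; rewrite setSD // proper_sub.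
  have UT0 : diag_block A (U :\: T) = 0.
    by apply: diag_block_sub0 US0; rewrite setDS // proper_sub.
  have SUc : path (fun S T : {set 'I_N} => S \proper T) S (U :: c).
    by case/andP: TUc => _ Uc; apply/andP; split=> //; apply: proper_trans TU.
  by have := IH S AS SUc Ac'; rewrite /= US0 TS0 UT0 !eqxx.
have := IH T AT TUc Ac'; set m := merge_zeros_from _ _ _; rewrite /=.
case: (diag_block A (T :\: S) =P 0) => TS; case: (diag_block A (U :\: T) =P 0) => UT /=.
- by case: US; apply: (diag_block_adjacent_zeros _ _ r A S T U).
- lia.
- lia.
- lia.
Qed.

(** * Sums over gaps and the final counts *)

Lemma path_proper_last_sub N (S : {set 'I_N}) c :
  path (fun S T : {set 'I_N} => S \proper T) S c -> S \subset last S c.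
Proof.
elim: c S => [|T c IH] S //= /andP[/proper_sub ST /IH]; exact: subset_trans.
Qed.

(** The gaps of an increasing chain partition the difference of its two ends. *)
Lemma sum_gaps (V : nmodType) N (f : 'I_N -> V) S c :
  path (fun S T : {set 'I_N} => S \proper T) S c ->
  \sum_(G <- pairmap (fun S T => T :\: S) S c) \sum_(i in G) f i =
  \sum_(i in last S c :\: S) f i.
Proof.
elim: c S => [|T c IH] S /=; first by rewrite big_nil setDv big_set0.
case/andP=> /proper_sub ST pTc; have Tc := path_proper_last_sub _ _ _ pTc.
rewrite big_cons (IH _ pTc) (big_setID T (A := last T c :\: S)) /=.
congr (_ + _); apply: eq_bigl => i; rewrite !inE.
  by have := subsetP Tc i; case: (i \in T) => [->|]; rewrite ?andbT ?andbF.
by have := subsetP ST i; case: (i \in S) => [->|].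
Qed.

Theorem theorem4p1 (R : realType) (r N : nat) (A : 'M[R]_N)
    (c : seq {set 'I_N}) :
  (2 <= r)%N -> decomposable A -> nonneg_mx A -> r_potent r A ->
  maximal_std_chain A c ->
  [/\ forall G, G \in gaps c ->
        diag_block A G = 0 \/
        [/\ indecomposable (diag_block A G), r_potent r (diag_block A G) &
            (\rank (diag_block A G) <= r - 1)%N],
      (\rank A)%:R / (r - 1)%:R <= (nb_nonzero_blocks A c)%:R :> R /\
      (nb_nonzero_blocks A c <= \rank A)%N &
      (\rank A)%:R / (r - 1)%:R <= (size (merge_zeros A c))%:R :> R /\
      (size (merge_zeros A c) <= 2 * \rank A + 1)%N].
Proof.
move=> r2 _ A_ge0 Ar c_max.
have [[c_path c_last c_inv] _] := c_max.
have blocks G : G \in gaps c -> [/\ indecomposable (diag_block A G),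
    r_potent r (diag_block A G), (\rank (diag_block A G) <= r - 1)%N &
    \tr (diag_block (A ^+ r.-1) G) = (\rank (diag_block A G))%:R].
  case/(maximal_gap _ _ _ _ _ c_max) => S [T [-> AS AT ST min_ST]].
  have irr := diag_block_irreducible _ _ _ _ _ AS AT ST min_ST.
  have Br := diag_block_r_potent _ _ r _ _ _ AS AT Ar.
  split=> //.
  - by move/decomposable_closed => [H [/irr[]-> ]]; rewrite eqxx.
  - by apply: irreducible_r_potent_rank => // i j; rewrite mxE.
  - by rewrite diag_block_exp // (mxrank_r_potent _ _ r).
(* The comparison is made in [R], where ranks are traces of powers and the diagonal splits over the
   gaps. *)
have rankA : \rank A = (\sum_(G <- gaps c) \rank (diag_block A G))%N.
  apply/eqP; rewrite -(eqr_nat R) (mxrank_r_potent _ _ r) // natr_sum.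
  rewrite /mxtrace (eq_bigl (mem (last set0 c :\: set0))) => [|i]; last first.
    by rewrite c_last !inE.
  rewrite -sum_gaps // !big_seq; apply/eqP/eq_bigr => G /blocks[_ _ _ <-].
  by rewrite mxtrace_diag_block.
have n_count : nb_nonzero_blocks A c = (\sum_(G <- gaps c) (diag_block A G != 0%R))%N.
  by rewrite /nb_nonzero_blocks -sum1_count big_mkcond; apply: eq_bigr => G _; case: eqP.
have n_le : (nb_nonzero_blocks A c <= \rank A)%N.
  rewrite n_count rankA leq_sum // => G _.
  by rewrite -mxrank_eq0; case: (\rank _).
have rank_le : (\rank A <= nb_nonzero_blocks A c * (r - 1))%N.
  rewrite n_count rankA big_distrl /= big_seq [leqRHS]big_seq leq_sum // => G /blocks[_ _ le _].
  by case: eqP => [->|_]; rewrite ?mxrank0 ?mul1n.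
(* Serves both lower bounds, with [m] the number of nonzero blocks and then the number of merged
   blocks. *)
have le_div m : (nb_nonzero_blocks A c <= m)%N -> (\rank A)%:R / (r - 1)%:R <= m%:R :> R.
  move=> nm; rewrite ler_pdivrMr ?ltr0n ?subn_gt0 // -natrM ler_nat.
  by rewrite (leq_trans rank_le) // leq_mul2r nm orbT.
have /andP[n_size size_n] : (nb_nonzero_blocks A c <= size (merge_zeros A c)
    <= (nb_nonzero_blocks A c).*2 + (if c is T :: _ then diag_block A (T :\: set0) == 0%R else false))%N.
  apply: (size_merge_zeros_from _ _ r) => // [i j|T cT]; first by rewrite inE.
  exact/invariant_underP/c_inv.
split; first by move=> G /blocks[]; right.
  by split=> //; apply: le_div.
split; first exact: le_div.
(* The boolean for an initial zero block is at most 1, whence the [+ 1]. *)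
apply: leq_trans size_n _; rewrite -mul2n leq_add ?leq_mul //.
by case: (c) => // T c'; case: eqP.
Qed.
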